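(* Let $-\infty<l<u<\infty$ and let $f(y\mid \boldsymbol{X})$ be the target conditional density of a real response $Y$ given a covariate vector $\boldsymbol{X}$, with support $[l,u]$ in $y$. Let $\mathcal{P}_1,\dots,\mathcal{P}_K$ be equally sized, consecutive and non-overlapping bins (intervals) on the support $[l,u]$, where the number of bins $K$ depends on the sample size $n$. Let $\pi_k(\boldsymbol{X})=\int_{\mathcal{P}_k} f(y\mid\boldsymbol{X})\,dy$ be the true probability in bin $k$, and let $\hat\pi_k(\boldsymbol{X})$ be a classification estimator of $\pi_k(\boldsymbol{X})$ based on a sample of size $n$. Suppose that the target density and the classification estimator satisfy: (i) for all $y$ and $\boldsymbol{X}$, $f(y\mid\boldsymbol{X})<\infty$, $|f'(y\mid\boldsymbol{X})|<\infty$ and $|f''(y\mid\boldsymbol{X})|<\infty$; (ii) as $n\to\infty$, $K\to\infty$ and $K/n\to 0$; (iii) $\mathrm{Bias}(\hat\pi_k(\boldsymbol{X}))=o(1/K)$ for all $k\in\{1,2,\dots,K\}$; (iv) $\mathrm{Var}(\hat\pi_k(\boldsymbol{X}))=o(1/K^2)$ for all $k\in\{1,2,\dots,K\}$. Then the density estimator $$\hat f_K(y\mid\boldsymbol{X})=\sum_{k=1}^K \frac{1}{|\mathcal{P}_k|}\, I(y\in\mathcal{P}_k)\,\hat\pi_k(\boldsymbol{X})$$ is consistent, that is, its integrated mean squared error satisfies $$E\left[\int_l^u\left\{\hat f_K(y\mid\boldsymbol{X})-f(y\mid\boldsymbol{X})\right\}^2dy\right]\longrightarrow 0\quad\text{as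 } n\to\infty .$$
   Context: Primes denote derivatives with respect to $y$. The estimators $\hat\pi_k(\boldsymbol{X})$ may come from any classification model, where the classes are the bins into which $Y$ falls. $\mathrm{Bias}(\hat\pi_k(\boldsymbol{X}))=E[\hat\pi_k(\boldsymbol{X})]-\pi_k(\boldsymbol{X})$ and $\mathrm{Var}$ denotes variance; expectation, bias and variance are over the randomness of the training sample at a given value of $\boldsymbol{X}$. $I(\cdot)$ is the indicator function and $|\mathcal{P}_k|$ is the length of the interval $\mathcal{P}_k$. A density estimator is called consistent if its integrated mean squared error over $[l,u]$ tends to $0$ asymptotically. *)

(* Defs.v *)
From mathcomp Require Import all_boot all_order all_algebra.
From mathcomp Require Import all_classical all_reals all_analysis.

Set Implicit Arguments.
Unset Strict Implicit.
Unset Printing Implicit Defensive.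

Import Order.TTheory GRing.Theory Num.Theory.
Import numFieldNormedType.Exports.

Local Open Scope classical_set_scope.
Local Open Scope ring_scope.
Local Open Scope ereal_scope.

(* "a is the derivative of g at y", difference quotients being taken inside A;
   for A = `[l, u] this is the two-sided derivative in the interior and the
   one-sided derivative at the endpoints.  As a : R, the derivative is finite. *)
Definition is_derive_within (R : realType) (A : set R) (g : R -> R) (y a : R)
    : Prop :=
  (fun z : R => (g z - g y) / (z - y))%R @ within A y^' --> a.

(* f x y is a version of the conditional density of Y at y given X = x. *)
Definition is_conditional_density (R : realType) (p : nat)
    (d : measure_display) (Omega : measurableType d) (P : probability Omega R)
    (X : {RV P >-> p.-tuple R}) (Y : {RV P >-> R})
    (f : p.-tuple R -> R -> R) : Prop :=
  [/\ measurable_fun [set: p.-tuple R * R] (fun z => f z.1 z.2),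
      forall x y, (0 <= f x y)%R,
      forall x, \int[lebesgue_measure]_y (f x y)%:E = 1 &
      forall (A : set (p.-tuple R)) (B : set R), measurable A -> measurable B ->
        P (X @^-1` A `&` Y @^-1` B) =
        \int[distribution P X]_(x in A) \int[lebesgue_measure]_(y in B) (f x y)%:E].

Definition bin_length (R : realType) (B : interval R) : R :=
  fine (lebesgue_measure [set` B]).

(* Which of two neighbouring bins contains their common endpoint is left open. *)
Definition equal_bins (R : realType) (l u : R) (K : nat)
    (B : 'I_K -> interval R) : Prop :=
  [/\ \bigcup_k [set` B k] = `[l, u]%classic,
      trivIset [set: 'I_K] (fun k => [set` B k]),
      forall (i j : 'I_K) (a b : R),
        (i < j)%N -> a \in B i -> b \in B j -> (a <= b)%R &
      forall i j : 'I_K, bin_length (B i) = bin_length (B j)].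

Definition bin_probability (R : realType) (g : R -> R) (B : interval R)
    : \bar R :=
  \int[lebesgue_measure]_(y in [set` B]) (g y)%:E.

Definition density_estimator (R : realType) (K : nat) (B : 'I_K -> interval R)
    (q : 'I_K -> R) (y : R) : R :=
  (\sum_(k < K) (bin_length (B k))^-1 * \1_([set` B k]) y * q k)%R.

Definition bias (R : realType) (d : measure_display) (T : measurableType d)
    (P : probability T R) (Z : {RV P >-> R}) (theta : \bar R) : \bar R :=
  'E_P[Z] - theta.

(* a n k = o(r n) as n -> oo for all k < K n.  The range of k depends on n, so
   the o is uniform in k: max_(k < K n) |a n k| = o(r n). *)
Definition littleo_all (R : realType) (K : nat -> nat)
    (a : forall n, 'I_(K n) -> \bar R) (r : nat -> R) : Prop :=
  forall eps : R, (0 < eps)%R ->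
    \forall n \near \oo, forall k : 'I_(K n), `|a n k| <= (eps * r n)%:E.

Definition integrated_mse (R : realType) (d : measure_display)
    (T : measurableType d) (P : probability T R) (l u : R)
    (fhat : T -> R -> R) (g : R -> R) : \bar R :=
  \int[P]_s \int[lebesgue_measure]_(y in `[l, u]) ((fhat s y - g y) ^+ 2)%:E.

(* Main.v *)
(* The density f(.|x) is uniformly continuous on the compact [l, u] since it is
   differentiable there.  All bins have length h = (u - l)/K, so once h is small
   f(.|x) oscillates by at most e on each bin P_k, and pi_k / h approximates it
   there within e.  Hence on P_k
     (fhat - f)^2 <= 2 h^-2 (pihat_k - pi_k)^2 + 2 e^2,
   and integrating over [l, u], then over the sample, gives
     IMSE <= 2/h * sum_k E(pihat_k - pi_k)^2 + 2 e^2 (u - l)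
          <= 4/h * sum_k (Var_k + Bias_k^2) + 2 e^2 (u - l).
   The sum has K terms, each o(1/K^2), and 1/h = K/(u - l). *)
Require Import Defs.
From mathcomp Require Import all_boot all_order all_algebra.
From mathcomp Require Import all_classical all_reals all_analysis.
From mathcomp Require Import measurable_realfun lra ring.
Set Implicit Arguments.
Unset Strict Implicit.
Unset Printing Implicit Defensive.
Import Order.TTheory GRing.Theory Num.Theory.
Import numFieldNormedType.Exports.
Local Open Scope classical_set_scope.
Local Open Scope ring_scope.

(* No measurability is needed: the integral of a nonnegative function is a
   supremum over the simple functions below it. *)
Lemma le_integral_nonmeasurable (R : realType) (d : measure_display)
    (T : measurableType d) (mu : {measure set T -> \bar R}) (D : set T)
    (f1 f2 : T -> \bar R) :
  (forall x, D x -> 0 <= f1 x)%E -> (forall x, D x -> f1 x <= f2 x)%E ->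
  (\int[mu]_(x in D) f1 x <= \int[mu]_(x in D) f2 x)%E.
Proof.
move=> f10 f12; rewrite !(integral_mkcond D).
have g10 x : (0 <= (f1 \_ D) x)%E by apply: erestrict_ge0.
have g12 x : ((f1 \_ D) x <= (f2 \_ D) x)%E.
  by rewrite !patchE; case: ifPn => // /set_mem; apply: f12.
rewrite !ge0_integralTE// => [|x]; last exact: le_trans (g12 x).
apply: ereal_sup_le => _ /= [h hf1 <-]; exists h => // x.
exact: le_trans (g12 x).
Qed.

(** * Uniform continuity of the density on its support *)

(** Near [y] the difference quotient is within 1 of [a], so [|g z - g y|] is at most
    [(|a| + 1) * |z - y|]. The punctured filter says nothing at [z = y], which is a separate
    case. *)
Lemma is_derive_within_continuous (R : realType) (A : set R) (g : R -> R)
    (y a : R) : is_derive_within A g y a -> g z @[z --> within A (nbhs y)] --> g y.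
Proof.
move=> dg; apply/cvgrPdist_le => e e0; rewrite /= near_withinE.
have a1 : 0 < `|a| + 1 by rewrite ltr_wpDl.
move/cvgrPdist_lt : dg => /(_ _ ltr01); rewrite near_withinE near_withinE => dg.
have : nbhs y (ball y (e / (`|a| + 1))) by apply: nbhsx_ballx; exact: divr_gt0.
apply: filterS2 dg => z dgz yz Az.
have [->|zy] := eqVneq z y; first by rewrite subrr normr0 ltW.
have := dgz zy Az; set w := _ / _ => aw.
have -> : g y - g z = w * (y - z).
  by rewrite /w -(opprB z y) mulrN divfK ?subr_eq0// opprB.
have wle : `|w| <= `|a| + 1.
  have -> : w = a - (a - w) by lra.
  by rewrite (le_trans (ler_normB _ _))// lerD2l ltW.
rewrite normrM (le_trans (ler_wpM2r _ wle))//.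
by rewrite mulrC -ler_pdivlMr// ltW.
Qed.

(** Heine-Cantor through the near-covering form of compactness: a radius valid for all of [A] exists
    once each point has a neighbourhood on which all small radii work. *)
Lemma compact_uniformly_continuous (R : realType) (A : set R) (g : R -> R) :
  compact A -> (forall y, A y -> g z @[z --> within A (nbhs y)] --> g y) ->
  forall e : R, 0 < e -> \forall r \near 0^'+,
    forall y z, A y -> A z -> `|y - z| <= r -> `|g y - g z| <= e.
Proof.
move=> /compact_near_coveringP cA cg e e0.
suff : \forall r \near 0^'+, A `<=` (fun y => A y -> forall z, A z ->
    `|y - z| <= r -> `|g y - g z| <= e).
  by apply: filterS => r H y z Ay Az; exact: H.
apply: cA => y Ay.
have e2 : 0 < e / 2 by rewrite divr_gt0.
have /cvgrPdist_le/(_ _ e2) := cg _ Ay; rewrite near_withinE => -[r /= r0 yr].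
(* Halving the radius keeps both [y'] and [z] within [r] of [y], so two estimates [e / 2] combine
   through [g y]. *)
exists (ball y (r / 2), [set x | x < r / 2]) => /=.
  split; first by apply: nbhsx_ballx; rewrite divr_gt0.
  by apply: nbhs_right_lt; rewrite divr_gt0.
move=> [y' s] /= [yy' sr] Ay' z Az y'z.
have Hy' : `|g y - g y'| <= e / 2.
  by apply: yr => //; apply: lt_trans yy' _; lra.
have Hz : `|g y - g z| <= e / 2.
  apply: yr => //=; have -> : y - z = (y - y') + (y' - z) by lra.
  rewrite (le_lt_trans (ler_normD _ _))//; move: yy'; rewrite /ball/=; lra.
have -> : g y' - g z = (g y - g z) - (g y - g y') by lra.
by rewrite (le_trans (ler_normB _ _))//; lra.
Qed.

(** * Geometry of the bins *)

Section bins.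
Context (R : realType) (l u : R) (K : nat) (B : 'I_K -> interval R).
Hypotheses (lu : l < u) (eB : equal_bins l u B).

Lemma bin_subset (k : 'I_K) : [set` B k] `<=` `[l, u].
Proof. by case: eB => <- _ _ _ y By; exists k. Qed.

(** [fine] would send an infinite measure to 0; inclusion in [[l, u]] rules this out. *)
Lemma bin_lengthE (k : 'I_K) :
  lebesgue_measure [set` B k] = (bin_length (B k))%:E.
Proof.
rewrite /bin_length fineK// ge0_fin_numE//.
apply: (@le_lt_trans _ _ (lebesgue_measure `[l, u]%classic)).
  by apply: le_measure; rewrite ?inE//; exact: bin_subset.
by rewrite lebesgue_measure_itv/= lte_fin lu -EFinB ltry.
Qed.

Lemma bins_length_sum (k : 'I_K) : K%:R * bin_length (B k) = u - l.
Proof.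
case: eB => BU Btriv _ Beq.
apply: EFin_inj; transitivity (lebesgue_measure `[l, u]%classic); last first.
  by rewrite lebesgue_measure_itv/= lte_fin lu -EFinB.
have -> : `[l, u]%classic = \big[setU/set0]_(k < K) [set` B k].
  by rewrite -BU -(bigcup_pred predT); apply: eq_bigcupl; split.
rewrite measure_bigsetU_ord//=.
under eq_bigr do rewrite bin_lengthE (Beq _ k).
by rewrite sumEFin sumr_const card_ord mulr_natl.
Qed.

Lemma bin_length_gt0 (k : 'I_K) : 0 < bin_length (B k).
Proof.
have K0 : (0 < K%:R :> R) by rewrite ltr0n; case: K k => // -[].
by rewrite -(pmulr_rgt0 _ K0) (bins_length_sum k) subr_gt0.
Qed.

(** A bin is an interval, so it contains the whole segment from [a] to [b], and measure is
    monotone. *)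
Lemma bin_diameter (k : 'I_K) (a b : R) :
  a \in B k -> b \in B k -> `|a - b| <= bin_length (B k).
Proof.
wlog ab : a b / a <= b => [H aB bB|aB bB].
  by have [/H|/ltW/H] := leP a b; [exact|rewrite distrC; exact].
rewrite distrC ger0_norm ?subr_ge0//.
have [->|neab] := eqVneq a b; first by rewrite subrr ltW// bin_length_gt0.
have ltab : a < b by rewrite lt_neqAle neab.
rewrite -lee_fin -bin_lengthE.
have -> : (b - a)%:E = lebesgue_measure `[a, b]%classic.
  by rewrite lebesgue_measure_itv/= lte_fin ltab -EFinB.
apply: le_measure; rewrite ?inE//.
move=> z /=; rewrite in_itv/= => azb.
by apply: (@interval_is_interval _ (B k) a b).
Qed.

End bins.

(** * Squared error for a fixed sample *)

Section error_bounds.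
Context (R : realType) (l u : R) (K : nat) (B : 'I_K -> interval R).
Hypotheses (lu : l < u) (eB : equal_bins l u B).

(** The quotient is the mean of [g] over the bin, where [g] stays within [e] of [g y]. *)
Lemma bin_probability_approx (g : R -> R) (k : 'I_K) (e y : R) :
  measurable_fun setT g -> (forall t, 0 <= g t) -> 0 <= e -> y \in B k ->
  (forall t, t \in B k -> `|g y - g t| <= e) ->
  `|fine (bin_probability g (B k)) / bin_length (B k) - g y| <= e.
Proof.
move=> mg g0 e0 By gBk; have h0 := bin_length_gt0 lu eB k.
have mB : measurable [set` B k] by exact: measurable_itv.
have mgB : measurable_fun [set` B k] (fun t : R => (g t)%:E).
  by apply/measurable_EFinP; exact: measurable_funTS.
have intc c : (\int[lebesgue_measure]_(t in [set` B k]) c%:E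
    = (c * bin_length (B k))%:E)%E.
  by rewrite integral_cst//= (bin_lengthE lu eB).
have upper : (bin_probability g (B k) <= ((g y + e) * bin_length (B k))%:E)%E.
  rewrite -intc; apply: le_integral_nonmeasurable => t Bt; rewrite lee_fin//.
  by have := gBk _ Bt; rewrite ler_norml => /andP[]; lra.
(* Since [g y - e] may be negative, [e] is moved to the other side to keep both integrands
   nonnegative. *)
have lower : ((g y * bin_length (B k))%:E
    <= bin_probability g (B k) + (e * bin_length (B k))%:E)%E.
  rewrite -!intc -ge0_integralD//=; last by move=> t _; rewrite lee_fin.
  apply: le_integral_nonmeasurable => t Bt; rewrite -?EFinD lee_fin//.
  by have := gBk _ Bt; rewrite ler_norml => /andP[]; lra.
have fin : bin_probability g (B k) \is a fin_num.
  rewrite ge0_fin_numE; first exact: le_lt_trans upper (ltry _).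
  by apply: integral_ge0 => t _; rewrite lee_fin.
move: upper lower; rewrite -(fineK fin) -EFinD !lee_fin /=.
set p := fine _ => ple lep; rewrite ler_norml; apply/andP; split.
  by rewrite lerBrDr ler_pdivlMr// mulrDl mulNr; lra.
by rewrite lerBlDr ler_pdivrMr// addrC.
Qed.

Lemma density_estimator_bin (q : 'I_K -> R) (k : 'I_K) (y : R) :
  y \in B k -> density_estimator B q y = q k / bin_length (B k).
Proof.
move=> By; rewrite /density_estimator (bigD1 k)//= big1 ?addr0.
  by rewrite indicE mem_set// mulr1 mulrC.
move=> j jk; rewrite indicE memNset ?mulr0 ?mul0r// => Bj.
case: eB => _ /trivIsetP /(_ j k Logic.I Logic.I jk) /seteqP[/(_ y) + _] _ _.
by apply; split.
Qed.

(** Only the bin containing [y] matters; the sum with indicators gives a bound valid on all of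
    [[l, u]] that can be integrated term by term. *)
Lemma density_estimator_sqr_error (g : R -> R) (q : 'I_K -> R) (e y : R) :
  measurable_fun setT g -> (forall t, 0 <= g t) -> 0 <= e -> y \in `[l, u] ->
  (forall k t, y \in B k -> t \in B k -> `|g y - g t| <= e) ->
  (density_estimator B q y - g y) ^+ 2 <=
  \sum_(k < K) 2 / bin_length (B k) ^+ 2
      * (q k - fine (bin_probability g (B k))) ^+ 2 * \1_[set` B k] y
    + 2 * e ^+ 2.
Proof.
move=> mg g0 e0 ylu gB.
have [k _ By] : (\bigcup_k [set` B k]) y by case: eB => -> _ _ _.
rewrite (density_estimator_bin _ By) (bigD1 k)//= indicE mem_set// mulr1.
have := bin_probability_approx mg g0 e0 By (fun t => gB k t By).
set p := fine _; set h := bin_length _ => ae.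
set S := \sum_(i < K | _) _.
have S0 : 0 <= S.
  by apply: sumr_ge0 => i _; rewrite mulr_ge0 ?indicE// mulr_ge0 ?sqr_ge0// divr_ge0 ?sqr_ge0.
have {}ae : (p / h - g y) ^+ 2 <= e ^+ 2.
  by rewrite -[X in X <= _]real_normK ?num_real// lerXn2r// nnegrE.
have -> : 2 / h ^+ 2 * (q k - p) ^+ 2 = 2 * (q k / h - p / h) ^+ 2.
  by rewrite -mulrBl exprMn exprVn -mulrA (mulrC (h ^- 2)).
move: (q k / h) (p / h) ae => a b ae.
(* This square being nonnegative is [(s + t)^2 <= 2 s^2 + 2 t^2] with [s = a - b] and
   [t = b - g y]. *)
by have := sqr_ge0 (a - b - (b - g y)); nra.
Qed.

Lemma integral_density_estimator_sqr_error (g : R -> R) (q : 'I_K -> R) (e : R) :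
  measurable_fun setT g -> (forall t, 0 <= g t) -> 0 <= e ->
  (forall k y t, y \in B k -> t \in B k -> `|g y - g t| <= e) ->
  (\int[lebesgue_measure]_(y in `[l, u])
      ((density_estimator B q y - g y) ^+ 2)%:E <=
    \sum_(k < K) (2 / bin_length (B k)
      * (q k - fine (bin_probability g (B k))) ^+ 2)%:E
    + (2 * e ^+ 2 * (u - l))%:E)%E.
Proof.
move=> mg g0 e0 gB; set c := fun k => 2 / bin_length (B k) ^+ 2
      * (q k - fine (bin_probability g (B k))) ^+ 2.
have c0 k : 0 <= c k by rewrite mulr_ge0 ?sqr_ge0// divr_ge0 ?sqr_ge0.
have mind k : measurable_fun `[l, u] (fun y : R => (\1_[set` B k] y : R)%:E).
  by apply/measurable_EFinP; apply: measurable_indic; exact: measurable_itv.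
apply: (@le_trans _ _ (\int[lebesgue_measure]_(y in `[l, u])
   (\sum_(k < K) (c k)%:E * (\1_[set` B k] y)%:E + (2 * e ^+ 2)%:E))%E).
  apply: le_integral_nonmeasurable => y ylu; first by rewrite lee_fin sqr_ge0.
  under eq_bigr do rewrite -EFinM.
  rewrite sumEFin -EFinD lee_fin.
  by apply: density_estimator_sqr_error => // k t; exact: gB.
have ci0 k (y : R) : (0 <= (c k)%:E * (\1_[set` B k] y : R)%:E)%E.
  by rewrite -EFinM lee_fin mulr_ge0// indicE.
have mci k : measurable_fun `[l, u]
    (fun y : R => (c k)%:E * (\1_[set` B k] y : R)%:E)%E.
  by apply: emeasurable_funM.
rewrite ge0_integralD//=; last 3 first.
- by move=> y _; apply: sume_ge0.
- by apply: emeasurable_sum.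
- by move=> y _; rewrite lee_fin mulr_ge0// sqr_ge0.
rewrite ge0_integral_sum// integral_cst//= lebesgue_measure_itv/= lte_fin lu.
rewrite -EFinB -EFinM leeD2r//; apply: lee_sum => k _.
(* Each indicator integrates to the bin length, turning [2 / h^2] into [2 / h]. *)
rewrite ge0_integralZl_EFin//; last exact: mind.
rewrite integral_indic//=.
rewrite setIidl ?(bin_lengthE lu eB); last exact: bin_subset eB _.
have h0 := bin_length_gt0 lu eB k.
rewrite -EFinM lee_fin le_eqVlt; apply/orP; left; apply/eqP.
by rewrite /c; field; rewrite gt_eqF.
Qed.

End error_bounds.

(** * Mean squared error over the training sample *)

(** The identity of the mean squared error with variance plus squared bias is traded for an
    inequality with factor 2, which holds pointwise and leaves no cross term to integrate. *)
Lemma mse_le_variance_bias (R : realType) (d : measure_display)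
    (T : measurableType d) (P : probability T R) (Z : {RV P >-> R})
    (theta : \bar R) (v b : R) : theta \is a fin_num ->
  (`|bias Z theta| <= b%:E)%E -> ('V_P[Z] <= v%:E)%E ->
  (\int[P]_s ((Z s - fine theta) ^+ 2)%:E <= (2 * (v + b ^+ 2))%:E)%E.
Proof.
move=> /fineK <-; move: (fine theta) => p; rewrite /bias => Zb.
(* A finite bound on the bias excludes an infinite mean. *)
have [m Em] : exists m, ('E_P[Z] = m%:E)%E.
  by case: ('E_P[Z])%E Zb => [m _|//|//]; exists m.
rewrite /variance covariance.unlock Em expectation.unlock /=.
move: Zb; rewrite Em lee_fin => mpb Vv.
have mZ : measurable_fun setT (fun s => ((Z s - m) ^+ 2)%:E).
  apply/measurable_EFinP; apply: measurable_funX; apply: measurable_funB => //.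
have mp : (m - p) ^+ 2 <= b ^+ 2.
  rewrite -[X in X <= _]real_normK ?num_real// lerXn2r// nnegrE//.
  exact: le_trans mpb.
apply: (@le_trans _ _ (\int[P]_s
   (2%:E * ((Z s - m) ^+ 2)%:E + (2 * b ^+ 2)%:E))%E).
  apply: le_integral_nonmeasurable => s _; first by rewrite lee_fin sqr_ge0.
  rewrite -EFinM -EFinD lee_fin.
  by have := sqr_ge0 (Z s - m - (m - p)); nra.
have i0 s : (0 <= ((Z s - m) ^+ 2)%:E)%E by rewrite lee_fin sqr_ge0.
rewrite ge0_integralD//=; last 3 first.
- by move=> s _; rewrite mule_ge0// lee_fin.
- by apply: emeasurable_funM.
- by move=> s _; rewrite lee_fin mulr_ge0// sqr_ge0.
rewrite ge0_integralZl_EFin// integral_cst//= probability_setT mule1.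
rewrite (mulrDr 2 v) (EFinD (2 * v)).
by apply: leeD2r; rewrite EFinM; apply: lee_wpmul2l.
Qed.

Lemma bin_probability_fin_num (R : realType) (g : R -> R) (B : interval R) :
  measurable_fun setT g -> (forall y, 0 <= g y) ->
  (\int[lebesgue_measure]_y (g y)%:E < +oo)%E ->
  bin_probability g B \is a fin_num.
Proof.
move=> mg g0 gfin; rewrite ge0_fin_numE.
  apply: le_lt_trans gfin; apply: ge0_subset_integral => //.
    exact/measurable_EFinP.
  by move=> y _; rewrite lee_fin.
by apply: integral_ge0 => y _; rewrite lee_fin.
Qed.

Lemma integrated_mse_ge0 (R : realType) (d : measure_display)
    (T : measurableType d) (P : probability T R) (l u : R)
    (fhat : T -> R -> R) (g : R -> R) : (0 <= integrated_mse P l u fhat g)%E.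
Proof.
rewrite /integrated_mse; apply: integral_ge0 => s _.
by apply: integral_ge0 => y _; rewrite lee_fin sqr_ge0.
Qed.

(** Each of the [K] bins contributes at most [2 * (v + b^2)], with weight [2 / h = 2 K / (u - l)];
    this is the source of [4] and [K^2]. *)
Lemma integrated_mse_le (R : realType) (l u : R) (K : nat)
    (B : 'I_K -> interval R) (d : measure_display) (T : measurableType d)
    (P : probability T R) (Z : 'I_K -> {RV P >-> R}) (g : R -> R) (e v b : R) :
  l < u -> equal_bins l u B ->
  measurable_fun setT g -> (forall y, 0 <= g y) ->
  (\int[lebesgue_measure]_y (g y)%:E < +oo)%E -> 0 <= e ->
  (forall k y t, y \in B k -> t \in B k -> `|g y - g t| <= e) ->
  (forall k, `|bias (Z k) (bin_probability g (B k))| <= b%:E)%E ->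
  (forall k, 'V_P[Z k] <= v%:E)%E ->
  (integrated_mse P l u (fun s => density_estimator B (fun k => Z k s)) g <=
   (4 * (v + b ^+ 2) * K%:R ^+ 2 / (u - l) + 2 * e ^+ 2 * (u - l))%:E)%E.
Proof.
move=> lu eB mg g0 gfin e0 gB hb hv.
have ul0 : 0 < u - l by rewrite subr_gt0.
have lenE k : 2 / bin_length (B k) = 2 * K%:R / (u - l).
  have h0 := bin_length_gt0 lu eB k; rewrite -(bins_length_sum lu eB k).
  have K0 : (K%:R != 0 :> R) by rewrite pnatr_eq0; case: K k {B Z eB gB hb hv h0} => -[].
  by field; rewrite K0 gt_eqF.
pose p k := fine (bin_probability g (B k)).
pose c := 2 * K%:R / (u - l).
have c0 : 0 <= c by rewrite divr_ge0 ?mulr_ge0 ?(ltW ul0).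
(* The inner integral is bounded for each sample [s] first, so the order of integration is never
   exchanged. *)
apply: (@le_trans _ _ (\int[P]_s (\sum_(k < K) c%:E * ((Z k s - p k) ^+ 2)%:E
    + (2 * e ^+ 2 * (u - l))%:E))%E).
  apply: le_integral_nonmeasurable => s _.
    by apply: integral_ge0 => y _; rewrite lee_fin sqr_ge0.
  apply: le_trans (integral_density_estimator_sqr_error lu eB _ mg g0 e0 gB) _.
  by rewrite leeD2r//; apply: lee_sum => k _; rewrite lenE EFinM.
have Z0 k s : (0 <= ((Z k s - p k) ^+ 2)%:E)%E by rewrite lee_fin sqr_ge0.
have cZ0 k s : (0 <= c%:E * ((Z k s - p k) ^+ 2)%:E)%E by rewrite mule_ge0.
have mZ k : measurable_fun setT (fun s => ((Z k s - p k) ^+ 2)%:E).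
  by apply/measurable_EFinP; apply: measurable_funX; apply: measurable_funB.
have mcZ k : measurable_fun setT (fun s => c%:E * ((Z k s - p k) ^+ 2)%:E)%E.
  by apply: emeasurable_funM.
rewrite ge0_integralD//=; last 3 first.
- by move=> s _; apply: sume_ge0.
- by apply: emeasurable_sum.
- by move=> s _; rewrite lee_fin mulr_ge0 ?(ltW ul0)// mulr_ge0 ?sqr_ge0.
rewrite ge0_integral_sum// integral_cst//= probability_setT mule1.
rewrite (EFinD (4 * _ * _ / _)); apply: leeD2r.
apply: (@le_trans _ _ (\sum_(k < K) (c * (2 * (v + b ^+ 2)))%:E)%E).
  apply: lee_sum => k _; rewrite ge0_integralZl_EFin// (EFinM c) lee_wpmul2l//.
  by apply: mse_le_variance_bias => //; exact: bin_probability_fin_num.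
rewrite sumEFin sumr_const card_ord -[X in (X%:E <= _)%E]mulr_natl lee_fin.
rewrite /c le_eqVlt; apply/orP; left; apply/eqP.
by field; rewrite gt_eqF.
Qed.

(** * Choice of constants and passage to the limit *)

Theorem theorem1 (R : realType) (l u : R) (hlu : l < u)
  (* response Y, covariate vector X, conditional density f with support [l, u] *)
  (p : nat) (d : measure_display) (Omega : measurableType d)
  (P : probability Omega R) (X : {RV P >-> p.-tuple R}) (Y : {RV P >-> R})
  (f f' f'' : p.-tuple R -> R -> R)
  (hf : is_conditional_density X Y f)
  (hsupp : forall x, closure [set y | f x y != 0] = `[l, u]%classic)
  (* K n equal bins at sample size n *)
  (K : nat -> nat) (B : forall n, 'I_(K n) -> interval R)
  (hB : forall n, equal_bins l u (@B n))
  (* law of the training sample of size n; classification estimators *)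
  (Q : forall n, probability (n.-tuple (p.-tuple R * R)%type) R)
  (pihat : forall n, 'I_(K n) -> p.-tuple R -> {RV (Q n) >-> R})
  (* (i) *)
  (hf' : forall x y, y \in `[l, u] ->
     is_derive_within `[l, u]%classic (f x) y (f' x y))
  (hf'' : forall x y, y \in `[l, u] ->
     is_derive_within `[l, u]%classic (f' x) y (f'' x y))
  (* (ii) *)
  (hK : K @ \oo --> \oo)
  (hKn : (K n)%:R / n%:R @[n --> \oo] --> (0 : R))
  (x : p.-tuple R)
  (* (iii) *)
  (hbias : littleo_all
     (fun n (k : 'I_(K n)) =>
        bias (pihat n k x) (bin_probability (f x) (B n k)))
     (fun n => 1 / (K n)%:R))
  (* (iv) *)
  (hvar : littleo_all
     (fun n (k : 'I_(K n)) => 'V_(Q n)[pihat n k x]%E)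
     (fun n => 1 / (K n)%:R ^+ 2)) :
  integrated_mse (Q n) l u
    (fun s => density_estimator (B n) (fun k => pihat n k x s)) (f x)
  @[n --> \oo] --> 0%E.
Proof.
have [mf f0 f1 _] := hf.
have mg : measurable_fun setT (f x) by exact: measurable_fun_pair2 x mf.
have gfin : (\int[lebesgue_measure]_y (f x y)%:E < +oo)%E by rewrite f1 ltry.
have ul0 : 0 < u - l by rewrite subr_gt0.
(* The error is nonnegative, so eventual bounds by every [e] suffice; the bound by 1 gives the
   eventual finiteness. *)
suff bound e : 0 < e -> \forall n \near \oo,
    (integrated_mse (Q n) l u
      (fun s => density_estimator (B n) (fun k => pihat n k x s)) (f x) <= e%:E)%E.
  apply/fine_cvgP; split.
    apply: filterS (bound 1 ltr01) => n le1.
    rewrite ge0_fin_numE ?integrated_mse_ge0//.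
    exact: le_lt_trans le1 (ltry _).
  apply/cvgrPdist_le => e e0; apply: filterS (bound e e0) => n lee /=.
  rewrite sub0r normrN ger0_norm ?fine_ge0 ?integrated_mse_ge0//.
  rewrite -lee_fin fineK// ge0_fin_numE ?integrated_mse_ge0//.
  exact: le_lt_trans lee (ltry _).
(* One [delta] serves for oscillation, bias and variance. The final bound is [4 (delta + delta^2) /
   (u - l) + 2 delta^2 (u - l)], at most [delta * c] once [delta <= 1]. *)
move=> e0; pose c := 8 / (u - l) + 2 * (u - l).
have c0 : 0 < c by rewrite addr_gt0 ?divr_gt0 ?mulr_gt0.
pose delta := Num.min 1 (e / c).
have d0 : 0 < delta by rewrite lt_min ltr01 divr_gt0.
have d1 : delta <= 1 by rewrite ge_min lexx.
have dc : delta * c <= e by rewrite -ler_pdivlMr// ge_min lexx orbT.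
have [r [r0 fr]] : exists r : R, 0 < r /\ forall y z, `[l, u]%classic y ->
    `[l, u]%classic z -> `|y - z| <= r -> `|f x y - f x z| <= delta.
  have cf : forall y, `[l, u]%classic y ->
      f x z @[z --> within `[l, u]%classic (nbhs y)] --> f x y.
    by move=> y ylu; apply: is_derive_within_continuous; exact: hf'.
  have := compact_uniformly_continuous (@segment_compact _ l u) cf d0.
  move=> /(filterI (nbhs_right_gt 0)) /filter_ex[r [r0 fr]].
  by exists r.
(* This forces [(u - l) / r < K n], that is, bins shorter than [r]. *)
have nearK : \forall n \near \oo, (Num.truncn ((u - l) / r) < K n)%N.
  exact: (cvgnyPge K).1 hK _.
(* Uniformity in [k] of the little-o conditions lets one threshold on [n] serve all bins. *)
apply: filterS3 (hbias _ d0) (hvar _ d0) nearK => n biasn varn Kn.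
have Kr : (u - l) / r < (K n)%:R.
  by rewrite (lt_le_trans (truncnS_gt _))// ler_nat.
have K0 : 0 < (K n)%:R :> R by apply: le_lt_trans Kr; rewrite divr_ge0 ?ltW.
have fB k y t : y \in B n k -> t \in B n k -> `|f x y - f x t| <= delta.
  move=> yB tB; apply: fr; [exact: bin_subset (hB n) _ _ yB| |].
    exact: bin_subset (hB n) _ _ tB.
  rewrite (le_trans (bin_diameter hlu (hB n) yB tB))//.
  rewrite -(ler_pM2l K0) (bins_length_sum hlu (hB n)).
  by rewrite -ler_pdivrMr// ltW.
have {}varn k : ('V_(Q n)[pihat n k x] <= (delta * (1 / (K n)%:R ^+ 2))%:E)%E.
  exact: le_trans (lee_abs _) (varn k).
apply: le_trans (integrated_mse_le hlu (hB n) mg (f0 x) gfin (ltW d0) fB biasn varn) _.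
rewrite lee_fin; apply: le_trans dc.
(* With [v = delta / K^2] and [b = delta / K], all powers of [K] cancel. *)
rewrite [X in X <= _](_ : _ = 4 * (delta + delta ^+ 2) / (u - l)
    + 2 * delta ^+ 2 * (u - l)); last by field; rewrite !gt_eqF.
have dd : delta ^+ 2 <= delta by rewrite expr2 ler_piMl// ltW.
have := invr_ge0 (u - l); rewrite (ltW ul0) /c => w0.
move: (u - l) ((u - l)^-1) (delta) dd ul0 w0 => h w D DD h0 w0.
have w1 : 4 * (D + D ^+ 2) * w <= D * (8 * w).
  by rewrite (_ : D * (8 * w) = 4 * (D + D) * w) ?ler_wpM2r ?ler_pM2l ?lerD2l//; lra.
have h1 : 2 * D ^+ 2 * h <= D * (2 * h).
  by rewrite (_ : D * (2 * h) = 2 * D * h) ?ler_wpM2r ?ler_pM2l ?(ltW h0)//; lra.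
by rewrite (mulrDr D) lerD.
Qed.
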